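(* Let $P_k(z,w)=k-p(z,w)$, $k>0$, be a one-parameter family of Newton polynomials as described in the context, where $p$ is a fixed Laurent polynomial in $(z,w)$ with no constant term. For every $k>\max_{|z|=|w|=1}|p(z,w)|$, the Mahler measure $m(P_k)$ is differentiable in $k$ and $$\frac{\mathrm{d}\,m(P_k)}{\mathrm{d}\log k}=u_0(k),$$ where $$u_0(k)=\frac{1}{(2\pi i)^2}\int_{|z|=|w|=1}\frac{1}{1-k^{-1}p(z,w)}\,\frac{\mathrm{d}z}{z}\frac{\mathrm{d}w}{w}.$$
   Context: The Mahler measure of a nonzero Laurent polynomial $P(z,w)$ is $m(P)=\int_0^1\int_0^1\log|P(e^{2\pi i\theta},e^{2\pi i\phi})|\,\mathrm{d}\theta\,\mathrm{d}\phi$. Dimers and Newton polynomials. Let $\mathcal G$ be a $\mathbb Z^2$-periodic bipartite graph in the plane with fundamental domain $\mathcal G_1=\mathcal G/\mathbb Z^2$ on the torus, with positive edge weights. The Kasteleyn matrix has rows indexed by white nodes and columns by black nodes of $\mathcal G_1$, with entries the edge weights times signs $\pm1$ such that around each face the number of minus signs is odd if the face has $0 \bmod 4$ edges and even if it has $2\bmod 4$ edges. Let $\gamma_x,\gamma_y$ be closed paths winding horizontally and vertically around the torus; multiply each edge weight by $z^{\pm1}$ (resp. $w^{\pm1}$) whenever $\gamma_x$ (resp. $\gamma_y$) crosses the edge with its black node on the left/right, obtaining $K(z,w)$. The Newton polynomial is $\det K(z,w)$, considered up to multiplication by a monomial, an overall sign and an overall positive constant. It has real coefficients. Standing setting: one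 writes the Newton polynomial of a dimer for some choice of edge weights as (constant) $-\,p(z,w)$ with $p$ a real Laurent polynomial without constant term; then $p$ is kept fixed and the constant is replaced by a free parameter $k>0$. In this setting $\max_{|z|=|w|=1}|p(z,w)|=p(1,1)$. *)

(* Defs.v *)
From HB Require Import structures.
From mathcomp Require Import all_boot all_order all_fingroup all_algebra.
From mathcomp Require Import finmap complex.
From mathcomp Require Import all_classical all_reals all_analysis.

Set Implicit Arguments.
Unset Strict Implicit.
Unset Printing Implicit Defensive.

Import Order.TTheory GRing.Theory Num.Theory.
Import numFieldNormedType.Exports.

Local Open Scope complex_scope.
Local Open Scope classical_set_scope.
Local Open Scope ring_scope.

(** * Bipartite graphs on the torus

  The quotient of a Z^2-periodic bipartite plane graph is a connected bipartite
  graph drawn on the torus with polygonal faces, given here by its rotation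
  system.  Multiple edges are allowed.  [rot_b e] (resp. [rot_w e]) is the edge
  following [e] counterclockwise around its black (resp. white) end.  There are
  [n] white and [n] black nodes, so that the Kasteleyn matrix is square.

  Traverse [e] from black to white with the face F on the right; the boundary
  of F continues along [rot_w e], from white to black, and then along
  [rot_b (rot_w e)], again from black to white.  Hence the faces are the cycles
  of [e |-> rot_b (rot_w e)], a cycle of length m being a face with 2m edges
  (products in [{perm _}] compose from left to right). *)

Definition face_perm (E : finType) (rot_b rot_w : {perm E}) : {perm E} :=
  (rot_w * rot_b)%g.

Record torus_graph (n : nat) := TorusGraph {
  edge : finType;
  rot_b : {perm edge};
  rot_w : {perm edge};
  black : edge -> 'I_n;
  white : edge -> 'I_n;
  black_onto : forall j : 'I_n, exists e : edge, black e = j;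
  white_onto : forall i : 'I_n, exists e : edge, white e = i;
  black_cycle : forall e e' : edge,
    (black e' == black e) = (e' \in porbit rot_b e);
  white_cycle : forall e e' : edge,
    (white e' == white e) = (e' \in porbit rot_w e);
  graph_connected : forall e e' : edge,
    connect [rel x y | (black x == black y) || (white x == white y)] e e';
  (* Euler characteristic 0: #nodes + #faces = #edges *)
  euler_torus : (n + n + #|porbits (face_perm rot_b rot_w)| = #|edge|)%N
}.

Section TorusGraph.
Variables (n : nat) (G : torus_graph n).

Definition faces : {set {set edge G}} :=
  porbits (face_perm (rot_b G) (rot_w G)).

(* [s e] means that the edge [e] carries a minus sign.  The boundary walk of
   the face [f] consists of the edges [e] and [rot_w e] for [e] in [f]. *)
Definition kasteleyn_sign (s : edge G -> bool) : Prop :=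
  forall f : {set edge G}, f \in faces ->
    odd (\sum_(e in f) (s e + s (rot_w G e)))%N = (4 %| 2 * #|f|)%N.

(** ** Closed paths on the torus

  A closed path transverse to the graph is recorded by the cyclic list of its
  crossings [(e, b)], where [b] tells whether the black end of [e] is on the
  left ([true]) or on the right ([false]) of the path. *)

(* Faces on the right and on the left of [e] traversed from black to white. *)
Definition right_face (e : edge G) : {set edge G} :=
  porbit (face_perm (rot_b G) (rot_w G)) e.
Definition left_face (e : edge G) : {set edge G} :=
  right_face ((rot_w G)^-1%g e).

Definition crossing_src (x : edge G * bool) : {set edge G} :=
  if x.2 then right_face x.1 else left_face x.1.
Definition crossing_tgt (x : edge G * bool) : {set edge G} :=
  if x.2 then left_face x.1 else right_face x.1.

Definition closed_path (g : seq (edge G * bool)) : bool :=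
  path.cycle [rel x y | crossing_tgt x == crossing_src y] g.

Definition crossing_number (g : seq (edge G * bool)) (e : edge G) : int :=
  (count_mem (e, true) g)%:Z - (count_mem (e, false) g)%:Z.

(* Integral 1-cycles of the graph, its edges being oriented from white to
   black. *)
Definition one_cycle (c : edge G -> int) : Prop :=
  (forall j : 'I_n, \sum_(e | black e == j) c e = 0) /\
  (forall i : 'I_n, \sum_(e | white e == i) c e = 0).

(* [gx] and [gy] wind once around two independent directions of the torus,
   that is, they form a Z-basis of its first homology group: by Poincare
   duality, this means that the algebraic numbers of crossings of a cycle of
   the graph with [gx] and [gy] take all values in Z^2.  Any such basis is
   (horizontal, vertical) for a suitable identification of the torus with
   R^2/Z^2. *)
Definition winding_pair (gx gy : seq (edge G * bool)) : Prop :=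
  [/\ closed_path gx, closed_path gy &
      forall a b : int, exists c : edge G -> int,
        [/\ one_cycle c,
            \sum_e c e * crossing_number gx e = a &
            \sum_e c e * crossing_number gy e = b]].

Definition kasteleyn_matrix (R : realType) (wt : edge G -> R)
    (s : edge G -> bool) (gx gy : seq (edge G * bool)) (z w : R[i]) :
    'M[R[i]]_n :=
  \matrix_(i, j) \sum_(e | (white e == i) && (black e == j))
    (-1) ^+ s e * (wt e)%:C * z ^ crossing_number gx e
                            * w ^ crossing_number gy e.

End TorusGraph.

(** * Laurent polynomials *)

(* Real Laurent polynomials in two variables: [p (a, b)] is the coefficient of
   z^a w^b. *)
Definition laurent (R : realType) := {fsfun (int * int)%type -> R with 0}.

Definition laurent_eval (R : realType) (p : laurent R) (z w : R[i]) : R[i] :=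
  \sum_(m <- finsupp p) (p m)%:C * z ^ m.1 * w ^ m.2.

(* [P] is a Newton polynomial of a dimer.  Laurent polynomials are compared as
   functions on (C^* )^2; the factor [c] accounts for the sign and the positive
   constant, [a] and [b] for the monomial. *)
Definition is_newton (R : realType) (P : R[i] -> R[i] -> R[i]) : Prop :=
  exists (n : nat) (G : torus_graph n) (wt : edge G -> R)
         (s : edge G -> bool) (gx gy : seq (edge G * bool))
         (c : R) (a b : int),
    [/\ forall e : edge G, 0 < wt e,
        kasteleyn_sign s,
        winding_pair gx gy,
        c != 0 &
        forall z w : R[i], z != 0 -> w != 0 ->
          P z w = c%:C * z ^ a * w ^ b * \det (kasteleyn_matrix wt s gx gy z w)].

Definition Pk (R : realType) (p : laurent R) (k : R) (z w : R[i]) : R[i] :=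
  k%:C - laurent_eval p z w.

(* Only one member of the family is required to come from edge weights: the
   constant is then turned into a free parameter. *)
Definition newton_family (R : realType) (p : laurent R) : Prop :=
  p (0, 0) = 0 /\ exists k0 : R, is_newton (Pk p k0).

(* A maximum, by compactness of the torus. *)
Definition torus_max (R : realType) (f : R[i] -> R[i] -> R[i]) : R :=
  sup [set r : R | exists z w : R[i],
         [/\ `|z| = 1, `|w| = 1 & r = Normc.normc (f z w)]].

(** * Integrals on the torus *)

(* exp(2 pi i t) *)
Definition cis (R : realType) (t : R) : R[i] :=
  cos (2 * pi * t) +i* sin (2 * pi * t).

Definition mahler_measure (R : realType) (P : R[i] -> R[i] -> R[i]) : R :=
  \int[lebesgue_measure]_(phi in `[0, 1])
    (\int[lebesgue_measure]_(theta in `[0, 1])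
       ln (Normc.normc (P (cis theta) (cis phi)))).

Definition two_pi_i (R : realType) : R[i] := 0 +i* (2 * pi).

(* The contour integral of f(z) dz over |z| = 1, with z = exp(2 pi i t) and
   dz = 2 pi i z dt. *)
Definition circle_integral (R : realType) (f : R[i] -> R[i]) : R[i] :=
  let g (t : R) := f (cis t) * (two_pi_i R * cis t) in
  (\int[lebesgue_measure]_(t in `[0, 1]) complex.Re (g t)) +i*
  (\int[lebesgue_measure]_(t in `[0, 1]) complex.Im (g t)).

Definition u0 (R : realType) (p : laurent R) (k : R) : R[i] :=
  ((two_pi_i R) ^+ 2)^-1 *
  circle_integral (fun w => circle_integral (fun z =>
    (1 - (k^-1)%:C * laurent_eval p z w)^-1 / z) / w).

(* d f / d log k *)
Definition log_derivative (R : realType) (f : R -> R) (k : R) : R :=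
  derive1 (fun s : R => f (expR s) : R^o) (ln k).

(* Main.v *)
Require Import Defs.
From HB Require Import structures.
From mathcomp Require Import all_boot all_order all_fingroup all_algebra.
From mathcomp Require Import finmap complex.
From mathcomp Require Import all_classical all_reals all_analysis.
From mathcomp Require Import ring lra.
Import Order.TTheory GRing.Theory Num.Theory.
Import numFieldNormedType.Exports.
Local Open Scope complex_scope.
Local Open Scope classical_set_scope.
Local Open Scope ring_scope.

(** On the torus |p| <= M := torus_max p < k, so ln |x - p| is smooth in x near
    k, with derivative Re (1 / (x - p)) bounded by 1 / (u - M) when x >= u > M.
    Differentiating under each of the two integral signs gives
    d m(P_k) / dk = int int Re (1 / (k - p)), and multiplying by k turns the
    integrand into the real part of the one of u_0.  The imaginary part of u_0
    vanishes because p has real coefficients: conjugating both variables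
    preserves the torus and conjugates the integrand. *)

(** * Continuity of real functions built pointwise *)

Section RealContinuity.
Context {R : realType}.
Implicit Types f g : R -> R.

Lemma eq_continuous f g : f =1 g -> continuous g -> continuous f.
Proof. by move/funext->. Qed.

Lemma continuous_add f g : continuous f -> continuous g ->
  continuous (fun t => f t + g t).
Proof. by move=> cf cg t; apply: cvgD; [exact: cf|exact: cg]. Qed.

Lemma continuous_sub f g : continuous f -> continuous g ->
  continuous (fun t => f t - g t).
Proof. by move=> cf cg t; apply: cvgB; [exact: cf|exact: cg]. Qed.

Lemma continuous_opp f : continuous f -> continuous (fun t => - f t).
Proof. by move=> cf t; apply: cvgN; exact: cf. Qed.

Lemma continuous_mul f g : continuous f -> continuous g ->
  continuous (fun t => f t * g t).
Proof. by move=> cf cg t; apply: cvgM; [exact: cf|exact: cg]. Qed.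

Lemma continuous_inv f : (forall t, f t != 0) -> continuous f ->
  continuous (fun t => (f t)^-1).
Proof. by move=> f0 cf t; apply: cvgV; [exact: f0|exact: cf]. Qed.

Lemma continuous_cst (c : R) : continuous (fun _ : R => c).
Proof. by move=> t; exact: cst_continuous. Qed.

End RealContinuity.

(** * Integrals over [0, 1]: continuity and differentiation in a parameter *)

Section UnitIntegral.
Context {R : realType}.
Notation mu := (@lebesgue_measure R).

(** [mahler_measure] and the components of [circle_integral] unfold to this, so results about it
    apply to them by conversion. *)
Definition unit_integral (f : R -> R) : R := \int[mu]_(t in `[0, 1]) f t.

Lemma integrable_unit (f : R -> R) :
  continuous f -> mu.-integrable `[0, 1] (EFin \o f).
Proof.
move=> cf; apply: continuous_compact_integrable; first exact: segment_compact.
exact: continuous_subspaceT.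
Qed.

Lemma eq_unit_integral (f g : R -> R) : f =1 g ->
  unit_integral f = unit_integral g.
Proof. by move=> fg; congr unit_integral; exact/funext. Qed.

Lemma unit_integral_cst (c : R) : unit_integral (fun=> c) = c.
Proof.
rewrite /unit_integral Rintegral_cst//= lebesgue_measure_itv/= lte01.
by rewrite oppr0 adde0 mulr1.
Qed.

Lemma unit_integralZ (c : R) (f : R -> R) : continuous f ->
  unit_integral (fun t => c * f t) = c * unit_integral f.
Proof.
by move=> cf; rewrite /unit_integral RintegralZl//; exact: integrable_unit.
Qed.

Lemma unit_integralD (f g : R -> R) : continuous f -> continuous g ->
  unit_integral (fun t => f t + g t) = unit_integral f + unit_integral g.
Proof.
by move=> cf cg; rewrite /unit_integral RintegralD//; exact: integrable_unit.
Qed.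

Lemma unit_integralB (f g : R -> R) : continuous f -> continuous g ->
  unit_integral (fun t => f t - g t) = unit_integral f - unit_integral g.
Proof.
by move=> cf cg; rewrite /unit_integral RintegralB//; exact: integrable_unit.
Qed.

Lemma norm_unit_integral_le (f : R -> R) (K : R) : continuous f ->
  (forall t, `|f t| <= K) -> `|unit_integral f| <= K.
Proof.
move=> cf fK; rewrite -[leRHS]unit_integral_cst.
apply: le_trans (le_normr_Rintegral _ (integrable_unit f cf)) _ => //.
apply: le_Rintegral => //; first exact/integrable_norm/integrable_unit.
exact/integrable_unit/continuous_cst.
Qed.

(** Dominated convergence: the constant [K] is integrable on [0, 1], so separate continuity and a
    uniform bound suffice. *)
Lemma continuous_unit_integral (f : R -> R -> R) (K : R) :
  (forall s, continuous (f s)) -> (forall t, continuous (f ^~ t)) ->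
  (forall s t, `|f s t| <= K) ->
  continuous (fun s => unit_integral (f s)).
Proof.
move=> cf1 cf2 fK s.
have mB : measurable (`[0, 1] : set R) by exact: measurable_itv.
(* Continuity at [s] is local; any open interval around [s] would do. *)
apply: (@continuity_under_integral R _ _ mu f `[0, 1] mB (s - 1) (s + 1) _ _
  (cst K)).
- by move=> x _; exact: integrable_unit.
- by apply: aeW => y _ x _; exact: cf2.
- exact/integrable_unit/continuous_cst.
- by move=> x _; apply: aeW => y _; exact: fK.
- by rewrite inE /= in_itv /= ltrBlDr ltrDl ltr01.
Qed.

(** The constant [K] dominates the derivatives on the whole interval around [a] and is integrable on
    [0, 1], which allows differentiation under the integral sign. *)
Lemma is_derive_unit_integral (f df : R -> R -> R) (K u v a : R) :
  a \in `]u, v[ -> (forall x, x \in `]u, v[ -> continuous (f x)) ->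
  (forall x t, x \in `]u, v[ -> is_derive x 1 (f ^~ t) (df x t)) ->
  (forall x t, x \in `]u, v[ -> `|df x t| <= K) ->
  is_derive a 1 (fun x => unit_integral (f x))
    (unit_integral (df a)).
Proof.
move=> auv cf dfE dfK.
(* [K] bounds an absolute value; the choice of 0 for [t] is arbitrary. *)
have K0 : 0 <= K by apply: le_trans (dfK a 0 auv).
have mB : measurable (`[0, 1]%classic : set (measurableTypeR R)).
  exact: measurable_itv.
have pE x t : x \in `]u, v[ -> partial1of2 f x t = df x t.
  by move=> xuv; rewrite partial1of2E; have [] := dfE x t xuv.
have h1 x : `]u, v[%classic x -> mu.-integrable `[0, 1] (EFin \o f x).
  by move=> xuv; apply: integrable_unit; exact: cf.
have h2 x t : `]u, v[%classic x -> `[0, 1]%classic t -> derivable (f ^~ t) x 1.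
  by move=> xuv _; have [] := dfE x t xuv.
have h3 : mu.-integrable `[0, 1] (EFin \o cst K).
  exact/integrable_unit/continuous_cst.
have h4 x t : `]u, v[%classic x -> `[0, 1]%classic t ->
    `|partial1of2 f x t| <= cst K t.
  by move=> xuv _; rewrite pE//; exact: dfK.
apply: DeriveDef.
  exact: (@derivable_under_integral R _ _ mu f _ mB a u v auv h1 h2 (cst K)
    (fun=> K0) h3 h4).
rewrite -derive1E.
have -> := @differentiation_under_integral R _ _ mu f _ mB a u v auv h1 h2
  (cst K) (fun=> K0) h3 h4.
by apply: eq_Rintegral => t _; exact: pE.
Qed.

(** Two applications of [is_derive_unit_integral]. As [0, 1] has length 1, the derivatives of the
    inner integrals are again bounded by [K]. The bounds [B], allowed to depend on [x], make the
    inner integral continuous in [s]. *)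
Lemma is_derive_unit_integral2 (f df : R -> R -> R -> R) (K u v a : R) :
  a \in `]u, v[ ->
  (forall x s, x \in `]u, v[ -> continuous (f x s)) ->
  (forall x t, x \in `]u, v[ -> continuous (f x ^~ t)) ->
  (forall x, x \in `]u, v[ -> exists B, forall s t, `|f x s t| <= B) ->
  (forall x s, x \in `]u, v[ -> continuous (df x s)) ->
  (forall x s t, x \in `]u, v[ ->
     is_derive x 1 (fun y => f y s t) (df x s t)) ->
  (forall x s t, x \in `]u, v[ -> `|df x s t| <= K) ->
  is_derive a 1
    (fun x => unit_integral (fun s => unit_integral (f x s)))
    (unit_integral (fun s => unit_integral (df a s))).
Proof.
move=> auv cf1 cf2 fB cdf dfE dfK.
have cI x : x \in `]u, v[ -> continuous (fun s => unit_integral (f x s)).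
  move=> xuv; have [B xB] := fB x xuv.
  by apply: (continuous_unit_integral (f x) B) => // ?; [exact: cf1|exact: cf2].
have dI x s : x \in `]u, v[ ->
    is_derive x 1 (fun y => unit_integral (f y s)) (unit_integral (df x s)).
  move=> xuv; exact: (is_derive_unit_integral (f ^~ s) (df ^~ s) K u v x xuv
    (fun y => cf1 y s) (fun y t => dfE y s t) (fun y t => dfK y s t)).
have bI x s : x \in `]u, v[ -> `|unit_integral (df x s)| <= K.
  move=> xuv; apply: norm_unit_integral_le; first exact: cdf.
  by move=> t; exact: dfK.
exact: (is_derive_unit_integral (fun x s => unit_integral (f x s))
  (fun x s => unit_integral (df x s)) K u v a auv cI dI bI).
Qed.

Lemma unit_integral_onem (f : R -> R) : continuous f ->
  unit_integral f = unit_integral (fun t => f (1 - t)).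
Proof.
move=> cf.
rewrite /unit_integral Rintegration_by_substitution_onem ?ler01 ?lexx//.
  (* The substitution produces 1 - 1 as lower endpoint. *)
  by rewrite [X in `[X, 1]](_ : _ = 0)//; exact: subrr.
exact: continuous_subspaceT.
Qed.

End UnitIntegral.

(** * Complex-valued functions of a real variable, handled by components *)

Section ComplexFunctions.
Context {R : realType}.
Implicit Types (f g : R -> R[i]).

(* Stated on components, to avoid relating the topology that R[i] inherits as a
   numFieldType to the one of R. *)
Definition ccontinuous f :=
  continuous (fun t => complex.Re (f t)) /\
  continuous (fun t => complex.Im (f t)).

Lemma ReM (x y : R[i]) : complex.Re (x * y) =
  complex.Re x * complex.Re y - complex.Im x * complex.Im y.
Proof. by case: x y => [a b] [c d]. Qed.

Lemma ImM (x y : R[i]) : complex.Im (x * y) =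
  complex.Re x * complex.Im y + complex.Im x * complex.Re y.
Proof. by case: x y => [a b] [c d]. Qed.

Lemma normc_sqr (x : R[i]) :
  Normc.normc x ^+ 2 = complex.Re x ^+ 2 + complex.Im x ^+ 2.
Proof. by case: x => a b; rewrite sqr_sqrtr// addr_ge0// sqr_ge0. Qed.

Lemma normc_gt0 (x : R[i]) : x != 0 -> 0 < Normc.normc x.
Proof.
move=> x0; rewrite lt_neqAle; apply/andP; split; last first.
  by case: x {x0} => a b; exact: sqrtr_ge0.
by apply: contra x0 => /eqP/esym/Normc.eq0_normc ->.
Qed.

Lemma ReV (x : R[i]) :
  complex.Re x^-1 = complex.Re x / Normc.normc x ^+ 2.
Proof. by rewrite normc_sqr; case: x. Qed.

Lemma ImV (x : R[i]) :
  complex.Im x^-1 = - (complex.Im x / Normc.normc x ^+ 2).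
Proof. by rewrite normc_sqr; case: x. Qed.

Lemma ler_abs_Re_normc (x : R[i]) : `|complex.Re x| <= Normc.normc x.
Proof. by have := normc_ge_Re x; rewrite normc_def lecR; case: x. Qed.

Lemma ler_abs_Im_normc (x : R[i]) : `|complex.Im x| <= Normc.normc x.
Proof. by case: x => a b; rewrite /= -sqrtr_sqr ler_wsqrtr// lerDr sqr_ge0. Qed.

Lemma normc_real (x : R) : Normc.normc x%:C = `|x|.
Proof. by rewrite /= expr0n addr0 sqrtr_sqr. Qed.

Lemma ccontinuous_cst (c : R[i]) : ccontinuous (fun=> c).
Proof. by split; exact: continuous_cst. Qed.

Lemma ccontinuousD f g : ccontinuous f -> ccontinuous g ->
  ccontinuous (fun t => f t + g t).
Proof.
move=> [rf jf] [rg jg]; split.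
- by apply: eq_continuous (continuous_add _ _ rf rg) => t; rewrite raddfD.
- by apply: eq_continuous (continuous_add _ _ jf jg) => t; rewrite raddfD.
Qed.

Lemma ccontinuousM f g : ccontinuous f -> ccontinuous g ->
  ccontinuous (fun t => f t * g t).
Proof.
move=> [rf jf] [rg jg]; split.
- apply: eq_continuous (fun t => ReM (f t) (g t)) _.
  by apply: continuous_sub; exact: continuous_mul.
- apply: eq_continuous (fun t => ImM (f t) (g t)) _.
  by apply: continuous_add; exact: continuous_mul.
Qed.

Lemma continuous_normc_sqr f : ccontinuous f ->
  continuous (fun t => Normc.normc (f t) ^+ 2).
Proof.
move=> [rf jf]; apply: eq_continuous (fun t => normc_sqr (f t)) _.
by apply: continuous_add; exact: continuous_mul.
Qed.

Lemma continuous_normc f : ccontinuous f ->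
  continuous (fun t => Normc.normc (f t)).
Proof.
move=> cf.
(* The squared modulus is polynomial in the components, hence continuous, and the square root is
   continuous everywhere, also at 0. *)
have sE t : Normc.normc (f t) = Num.sqrt (Normc.normc (f t) ^+ 2).
  by rewrite normc_sqr; case: (f t).
apply: eq_continuous sE _ => t.
by apply: (@continuous_comp _ _ _ (fun t => Normc.normc (f t) ^+ 2) Num.sqrt);
  [exact: continuous_normc_sqr|exact: sqrt_continuous].
Qed.

Lemma ccontinuousV f : (forall t, f t != 0) -> ccontinuous f ->
  ccontinuous (fun t => (f t)^-1).
Proof.
move=> f0 cf; have [rf jf] := cf.
have cV : continuous (fun t => (Normc.normc (f t) ^+ 2)^-1).
  apply: continuous_inv; last exact: continuous_normc_sqr.
  by move=> t; rewrite sqrf_eq0 gt_eqF// normc_gt0.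
split.
- by apply: eq_continuous (fun t => ReV (f t)) _; exact: continuous_mul.
- apply: eq_continuous (fun t => ImV (f t)) _.
  by apply: continuous_opp; exact: continuous_mul.
Qed.

Lemma ccontinuousX f (n : nat) : ccontinuous f ->
  ccontinuous (fun t => f t ^+ n).
Proof.
move=> cf; elim: n => [|n IH]; first exact: ccontinuous_cst.
by under eq_fun do rewrite exprS; exact: ccontinuousM.
Qed.

Lemma ccontinuousXz f (n : int) : (forall t, f t != 0) -> ccontinuous f ->
  ccontinuous (fun t => f t ^ n).
Proof.
move=> f0 cf; case: n => n; first exact: ccontinuousX.
apply: ccontinuousV; last exact: ccontinuousX.
by move=> t; rewrite expf_neq0.
Qed.

Lemma ccontinuous_sum (I : Type) (r : seq I) (F : I -> R -> R[i]) :
  (forall i, ccontinuous (F i)) ->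
  ccontinuous (fun t => \sum_(i <- r) F i t).
Proof.
move=> cF; elim: r => [|i r IH].
  by under eq_fun do rewrite big_nil; exact: ccontinuous_cst.
by under eq_fun do rewrite big_cons; exact: ccontinuousD.
Qed.

(** Componentwise like [circle_integral], which is by conversion the [cintegral] of its pulled-back
    integrand. *)
Definition cintegral f : R[i] :=
  unit_integral (fun t => complex.Re (f t)) +i*
  unit_integral (fun t => complex.Im (f t)).

Lemma cintegralZ (c : R[i]) f : ccontinuous f ->
  cintegral (fun t => c * f t) = c * cintegral f.
Proof.
move=> [rf jf]; apply/eqP; rewrite eq_complex ReM ImM /=.
have cZ (a : R) (h : R -> R) : continuous h -> continuous (fun t => a * h t).
  exact: continuous_mul (continuous_cst a).
apply/andP; split; apply/eqP.
- under eq_unit_integral do rewrite ReM.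
  by rewrite unit_integralB ?unit_integralZ//; exact: cZ.
- under eq_unit_integral do rewrite ImM.
  by rewrite unit_integralD ?unit_integralZ//; exact: cZ.
Qed.

Lemma ccontinuous_cintegral (h : R -> R -> R[i]) (K : R) :
  (forall s, ccontinuous (h s)) -> (forall t, ccontinuous (h ^~ t)) ->
  (forall s t, Normc.normc (h s t) <= K) ->
  ccontinuous (fun s => cintegral (h s)).
Proof.
move=> ch1 ch2 hK; split=> /=.
- apply: (continuous_unit_integral _ K) => [s|t|s t].
  + by case: (ch1 s). + by case: (ch2 t).
  + exact: le_trans (ler_abs_Re_normc _) (hK s t).
- apply: (continuous_unit_integral _ K) => [s|t|s t].
  + by case: (ch1 s). + by case: (ch2 t).
  + exact: le_trans (ler_abs_Im_normc _) (hK s t).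
Qed.

(** Replacing s and t by 1 - s and 1 - t conjugates [h], so the imaginary part of the double
    integral equals its own opposite and vanishes. *)
Lemma cintegral2_real (h : R -> R -> R[i]) (K : R) :
  (forall s, ccontinuous (h s)) -> (forall t, ccontinuous (h ^~ t)) ->
  (forall s t, Normc.normc (h s t) <= K) ->
  (forall s t, h (1 - s) (1 - t) = ((h s t)^*)%C) ->
  cintegral (fun s => cintegral (h s)) =
  (unit_integral (fun s => unit_integral (fun t => complex.Re (h s t))))%:C.
Proof.
move=> ch1 ch2 hK hJ; have [_ cI] := ccontinuous_cintegral _ _ ch1 ch2 hK.
set A := unit_integral (fun s => complex.Im (cintegral (h s))).
suff A0 : A = 0 by rewrite /cintegral/= -/A -[X in _ +i* X]/A A0.
have : A = - 1 * A.
  (* The factor - 1 is moved inside by linearity, so that the integrands can be compared pointwise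
     after reflecting [s], then [t]. *)
  rewrite [LHS]unit_integral_onem// -unit_integralZ//.
  apply: eq_unit_integral => s /=.
  have [_ ch1s] := ch1 s; have [_ ch1s'] := ch1 (1 - s).
  rewrite unit_integral_onem// -unit_integralZ//.
  by apply: eq_unit_integral => t; rewrite hJ mulN1r; case: (h s t).
by lra.
Qed.

End ComplexFunctions.

(** * The unit circle, and Laurent polynomials on the torus *)

Section UnitCircle.
Context {R : realType}.
Implicit Types (t : R) (z w : R[i]).

Lemma ccontinuous_cis : ccontinuous (@cis R).
Proof.
have c2 : continuous (fun t : R => 2 * pi * t).
  by apply: continuous_mul (continuous_cst _) _ => t; exact: cvg_id.
split=> t /=.
- by apply: (@continuous_comp _ _ _ (fun t : R => 2 * pi * t) cos);
    [exact: c2|exact: continuous_cos].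
- by apply: (@continuous_comp _ _ _ (fun t : R => 2 * pi * t) sin);
    [exact: c2|exact: continuous_sin].
Qed.

Lemma norm_cis t : `|cis t| = 1 :> R[i].
Proof. by rewrite normc_def /= cos2Dsin2 sqrtr1. Qed.

Lemma cis_neq0 t : cis t != 0.
Proof. by rewrite -normr_eq0 norm_cis oner_eq0. Qed.

(** The angle 2 pi (1 - t) is - 2 pi t up to a full turn, and conjugation negates the angle. *)
Lemma cis_onem t : cis (1 - t) = ((cis t)^*)%C.
Proof.
rewrite /cis mulrBr mulr1 mulr_natl.
rewrite -[in LHS]mulr_natl addrC mulr_natl cosD2pi sinD2pi.
by rewrite cosN sinN.
Qed.

Lemma two_pi_i_neq0 : two_pi_i R != 0.
Proof.
rewrite /two_pi_i eq_complex /= eqxx /= mulf_neq0 ?pnatr_eq0//.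
by rewrite gt_eqF// pi_gt0.
Qed.

(** For z = exp(2 pi i t) one has dz / z = 2 pi i dt: the factor [cis t] of dz cancels the division
    by z. *)
Lemma circle_integral_divE (F : R[i] -> R[i]) : ccontinuous (F \o @cis R) ->
  circle_integral (fun z => F z / z) =
  two_pi_i R * cintegral (F \o @cis R).
Proof.
move=> cF; rewrite -cintegralZ//; congr cintegral.
by apply/funext => t; rewrite /comp mulrCA divfK ?cis_neq0.
Qed.

(** The coefficients are real, hence fixed by conjugation. *)
Lemma laurent_evalJ (p : laurent R) z w :
  laurent_eval p z^*%C w^*%C = ((laurent_eval p z w)^*)%C.
Proof.
rewrite /laurent_eval rmorph_sum; apply: eq_bigr => m _.
by rewrite !rmorphM !fmorphXz/= oppr0.
Qed.

Lemma norm_exprz_unit z (n : int) : `|z| = 1 -> `|z ^ n| = 1.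
Proof.
by case: n => n z1; rewrite ?NegzE /exprz ?normfV normrX z1 expr1n ?invr1.
Qed.

(** [torus_max] is a supremum, so the set of values must be shown nonempty and bounded. Monomials
    have modulus 1 on the torus, so the sum of the absolute values of the coefficients is a
    bound. *)
Lemma norm_laurent_eval_le (p : laurent R) z w : `|z| = 1 -> `|w| = 1 ->
  Normc.normc (laurent_eval p z w) <= torus_max (laurent_eval p).
Proof.
move=> z1 w1; apply: sup_upper_bound; last by exists z, w.
split; first by exists (Normc.normc (laurent_eval p z w)), z, w.
(* Norms in [R[i]] are themselves elements of [R[i]]; the real part turns the sum into a bound in
   [R]. *)
exists (complex.Re (\sum_(m <- finsupp p) `|(p m)%:C|)).
move=> _ [z' [w' [z'1 w'1 ->]]].
have : `|laurent_eval p z' w'| <= \sum_(m <- finsupp p) `|(p m)%:C|.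
  apply: le_trans (ler_norm_sum _ _ _) _; apply: ler_sum => m _.
  by rewrite !normrM !norm_exprz_unit// !mulr1.
by rewrite lecE => /andP[_].
Qed.

End UnitCircle.

(** * The logarithm of |x - q| as a function of real x *)

Section LogNorm.
Context {R : realType}.

(** The modulus is at least the real part, and Re (x - q) >= x - |q| >= x - M. *)
Lemma normc_subr_ge (x M : R) (q : R[i]) : Normc.normc q <= M ->
  x - M <= Normc.normc (x%:C - q).
Proof.
move=> qM; apply: le_trans (ler_abs_Re_normc _); apply: le_trans (ler_norm _).
rewrite raddfB /= lerB//; apply: le_trans qM.
by apply: le_trans (ler_abs_Re_normc _); exact: ler_norm.
Qed.

Lemma is_derive_ln_normc (x : R) (q : R[i]) : Normc.normc q < x ->
  is_derive x 1 (fun y : R => ln (Normc.normc (y%:C - q)))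
    (complex.Re (x%:C - q)^-1).
Proof.
move=> qx.
have n0 : 0 < Normc.normc (x%:C - q).
  by apply: lt_le_trans (normc_subr_ge x _ q (lexx _)); rewrite subr_gt0.
rewrite ReV; case: q qx n0 => a b _ /=; rewrite sub0r sqrrN => n0.
set D := (x - a) ^+ 2 + b ^+ 2 in n0 *.
have D0 : 0 < D by rewrite -sqrtr_gt0.
pose N (y : R) := (y - a) ^+ 2 + b ^+ 2.
have dN : is_derive x 1 N (2 * (x - a)).
  by apply: is_derive_eq; rewrite /GRing.scale /=; ring.
have dsN := @is_derive1_comp R Num.sqrt N x _ _ (is_derive1_sqrt D0) dN.
have := @is_derive1_comp R (@ln R) (Num.sqrt \o N) x _ _
  (is_derive1_ln n0) dsN.
by rewrite (_ : _ * _ = (x - a) / Num.sqrt D ^+ 2)//; field; rewrite gt_eqF.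
Qed.

Lemma continuous_ln_normc (f : R -> R[i]) : (forall t, f t != 0) ->
  ccontinuous f -> continuous (fun t => ln (Normc.normc (f t))).
Proof.
move=> f0 cf t.
apply: (@continuous_comp _ _ _ (fun t => Normc.normc (f t)) (@ln R)).
  exact: continuous_normc.
by apply: continuous_ln; exact: normc_gt0.
Qed.

End LogNorm.

(** * The derivative of the Mahler measure in k, and the evaluation of u_0 *)

Section MahlerMeasure.
Context {R : realType}.
Variable p : laurent R.

(** The outer variable [s] is the angle of w and the inner variable [t] that of z, as in the order
    of integration of [mahler_measure] and [u0]. *)
Let q (s t : R) : R[i] := laurent_eval p (cis t) (cis s).
Let M : R := torus_max (laurent_eval p).

Lemma ccontinuous_laurent_eval (f g : R -> R[i]) :
  (forall t, f t != 0) -> (forall t, g t != 0) ->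
  ccontinuous f -> ccontinuous g ->
  ccontinuous (fun t => laurent_eval p (f t) (g t)).
Proof.
move=> f0 g0 cf cg; apply: ccontinuous_sum => m.
apply: ccontinuousM; last exact: ccontinuousXz.
by apply: ccontinuousM; [exact: ccontinuous_cst|exact: ccontinuousXz].
Qed.

Lemma q_normc_le s t : Normc.normc (q s t) <= M.
Proof. by apply: norm_laurent_eval_le; exact: norm_cis. Qed.

Lemma subq_normc_ge (x : R) s t : x - M <= Normc.normc (x%:C - q s t).
Proof. exact: normc_subr_ge (q_normc_le s t). Qed.

Lemma subq_neq0 (x : R) s t : M < x -> x%:C - q s t != 0.
Proof.
move=> Mx; apply: contraTneq Mx => x0; rewrite -leNgt -subr_le0.
by rewrite -(@Normc.normc0 R) -x0 subq_normc_ge.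
Qed.

Lemma ccontinuous_subq1 (x : R) s : ccontinuous (fun t => x%:C - q s t).
Proof.
(* The opposite becomes a product with - 1, so that closure under sums and products applies. *)
under [X in ccontinuous X]eq_fun do rewrite -mulN1r.
apply: ccontinuousD; first exact: ccontinuous_cst.
apply: ccontinuousM; first exact: ccontinuous_cst.
apply: ccontinuous_laurent_eval; do ?by move=> ?; exact: cis_neq0.
- exact: ccontinuous_cis.
- exact: ccontinuous_cst.
Qed.

Lemma ccontinuous_subq2 (x : R) t : ccontinuous (fun s => x%:C - q s t).
Proof.
under [X in ccontinuous X]eq_fun do rewrite -mulN1r.
apply: ccontinuousD; first exact: ccontinuous_cst.
apply: ccontinuousM; first exact: ccontinuous_cst.
apply: ccontinuous_laurent_eval; do ?by move=> ?; exact: cis_neq0.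
- exact: ccontinuous_cst.
- exact: ccontinuous_cis.
Qed.

(** The bound depends on [u] but not on [x], which is the domination needed on a whole interval. *)
Lemma subqV_normc_le (u x : R) s t : M < u -> u <= x ->
  Normc.normc (x%:C - q s t)^-1 <= (u - M)^-1.
Proof.
move=> Mu ux; have uM0 : 0 < u - M by rewrite subr_gt0.
have uq : u - M <= Normc.normc (x%:C - q s t).
  by apply: le_trans (subq_normc_ge x s t); rewrite lerD2r.
by rewrite Normc.normcV lef_pV2// posrE (lt_le_trans uM0).
Qed.

Lemma is_derive_mahler_measure (k : R) : M < k ->
  is_derive k 1 (fun x : R => mahler_measure (Pk p x))
    (unit_integral (fun s =>
       unit_integral (fun t => complex.Re (k%:C - q s t)^-1))).
Proof.
(* The midpoint keeps the interval from [u] to k + 1, which contains [k], away from [M]; the right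
   end k + 1 is arbitrary. *)
move=> Mk; pose u := (M + k) / 2.
have Mu : M < u by rewrite midf_lt.
have uk : u < k by rewrite midf_lt.
have Ix x : x \in `]u, k + 1[ -> M < x.
  by rewrite in_itv/= => /andP[/(lt_trans Mu)].
pose f x s t : R := ln (Normc.normc (x%:C - q s t)).
pose df x s t : R := complex.Re (x%:C - q s t)^-1.
have kI : k \in `]u, k + 1[ by rewrite in_itv/= uk ltrDl ltr01.
have cf1 x s : x \in `]u, k + 1[ -> continuous (f x s).
  move=> /Ix Mx; apply: continuous_ln_normc; last exact: ccontinuous_subq1.
  by move=> t; exact: subq_neq0.
have cf2 x t : x \in `]u, k + 1[ -> continuous (f x ^~ t).
  move=> /Ix Mx; apply: continuous_ln_normc; last exact: ccontinuous_subq2.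
  by move=> s; exact: subq_neq0.
have fB x : x \in `]u, k + 1[ -> exists B, forall s t, `|f x s t| <= B.
  (* Since x - M <= |x - q| <= |x| + M, the logarithm lies between those of the two ends. Their
     signs are unknown, so the absolute values are added to bound it on both sides. *)
  move=> /Ix Mx; exists (`|ln (x - M)| + `|ln (`|x| + M)|) => s t.
  have h0 : 0 < x - M by rewrite subr_gt0.
  have h1 := subq_normc_ge x s t.
  have h2 : Normc.normc (x%:C - q s t) <= `|x| + M.
    apply: le_trans (le_normcD _ _) _.
    by rewrite normc_real normcN lerD2l q_normc_le.
  have l1 : ln (x - M) <= f x s t by rewrite ler_ln// posrE (lt_le_trans h0).
  have l2 : f x s t <= ln (`|x| + M).
    by rewrite ler_ln// posrE (lt_le_trans h0)// (le_trans h1).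
  rewrite ler_norml; apply/andP; split.
    apply: le_trans l1; rewrite lerNl; apply: le_trans (ler_norm _) _.
    by rewrite normrN lerDl.
  by apply: (le_trans l2); apply: le_trans (ler_norm _) _; rewrite lerDr.
have cdf x s : x \in `]u, k + 1[ -> continuous (df x s).
  move=> /Ix Mx.
  by have [] := ccontinuousV _ (fun t => subq_neq0 x s t Mx)
    (ccontinuous_subq1 x s).
have dfE x s t : x \in `]u, k + 1[ ->
    is_derive x 1 (fun y => f y s t) (df x s t).
  move=> /Ix Mx; apply: is_derive_ln_normc.
  exact: le_lt_trans (q_normc_le s t) Mx.
have dfK x s t : x \in `]u, k + 1[ -> `|df x s t| <= (u - M)^-1.
  rewrite in_itv/= => /andP[/ltW ux _].
  exact: le_trans (ler_abs_Re_normc _) (subqV_normc_le u x s t Mu ux).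
exact: (is_derive_unit_integral2 f df _ u (k + 1) k kI cf1 cf2 fB cdf dfE dfK).
Qed.

(** Since 1 / (1 - q / k) = k / (k - q), a factor k comes out. Each contour integral contributes 2
    pi i, cancelled by the prefactor, and the remaining double integral is real by conjugation
    symmetry. *)
Lemma u0E (k : R) : 0 < k -> M < k ->
  u0 p k = (k * unit_integral (fun s =>
     unit_integral (fun t => complex.Re (k%:C - q s t)^-1)))%:C.
Proof.
move=> k0 Mk; pose h s t : R[i] := (k%:C - q s t)^-1.
have ch1 s : ccontinuous (h s).
  by apply: ccontinuousV (ccontinuous_subq1 k s) => t; exact: subq_neq0.
have ch2 t : ccontinuous (h ^~ t).
  by apply: ccontinuousV (ccontinuous_subq2 k t) => s; exact: subq_neq0.
have hK s t := subqV_normc_le k k s t Mk (lexx k).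
have hE s t : (1 - (k^-1)%:C * q s t)^-1 = k%:C * h s t.
  have kC0 : k%:C != 0 :> R[i] by rewrite eq_complex /= gt_eqF.
  rewrite -[k%:C in RHS]invrK -invfM; congr (_^-1).
  by rewrite mulrBr mulVf// fmorphV.
(* Reflecting both angles conjugates z and w, hence [q], while [k] is real. *)
have hJ s t : h (1 - s) (1 - t) = ((h s t)^*)%C.
  rewrite /h /q !cis_onem laurent_evalJ conjc_inv; congr (_^-1).
  by rewrite rmorphB /= oppr0.
have cc := ccontinuous_cintegral _ _ ch1 ch2 hK.
rewrite rmorphM /= -(cintegral2_real _ _ ch1 ch2 hK hJ) -cintegralZ//.
have inner s : circle_integral (fun z =>
    (1 - (k^-1)%:C * laurent_eval p z (cis s))^-1 / z) =
    two_pi_i R * (k%:C * cintegral (h s)).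
  have e : (fun z => (1 - (k^-1)%:C * laurent_eval p z (cis s))^-1) \o @cis R =
      fun t => k%:C * h s t by apply/funext => t; exact: hE.
  rewrite circle_integral_divE e; last first.
    by apply: ccontinuousM => //; exact: ccontinuous_cst.
  by rewrite cintegralZ.
rewrite /u0.
(* The outer integrand matters only at w = [cis s], where [inner] gives its value. *)
have e : (fun w => circle_integral (fun z =>
    (1 - (k^-1)%:C * laurent_eval p z w)^-1 / z)) \o @cis R =
    fun s => two_pi_i R * (k%:C * cintegral (h s)).
  by apply/funext => s; exact: inner.
have cc' : ccontinuous (fun s => k%:C * cintegral (h s)).
  by apply: ccontinuousM => //; exact: ccontinuous_cst.
rewrite circle_integral_divE e; last first.
  by apply: ccontinuousM => //; exact: ccontinuous_cst.
rewrite cintegralZ// mulrA -expr2 mulKf// expf_neq0//.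
exact: two_pi_i_neq0.
Qed.

End MahlerMeasure.

(** * From the derivative in k to the derivative in log k *)

Theorem mainTheorem1 (R : realType) (p : laurent R) (hp : newton_family p)
    (k : R) (hk0 : 0 < k) (hk : torus_max (laurent_eval p) < k) :
  derivable (fun x : R => mahler_measure (Pk p x) : R^o) k 1 /\
  (log_derivative (fun x : R => mahler_measure (Pk p x)) k)%:C = u0 p k.
Proof.
have := is_derive_mahler_measure p k hk; set d := unit_integral _ => dm.
split; first by case: dm.
rewrite u0E// /log_derivative derive1E; congr _%:C.
(* This uses k > 0. The chain rule at ln k then contributes the derivative of exp there, which is
   the factor k. *)
have lk : expR (ln k) = k by rewrite lnK.
have dm' : is_derive (expR (ln k)) 1 (fun x : R => mahler_measure (Pk p x)) d.
  by rewrite lk.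
have [_ ->] := is_derive1_comp dm' (is_derive_expR (ln k)).
by rewrite lk mulrC.
Qed.
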